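(* For every PLTL formula $A$, the resolution algorithm described in the context, applied to $A$, terminates.
   Context: PLTL formulae are built from proposition symbols, $\mathbf{true}$, $\mathbf{false}$, $\neg,\vee,\wedge,\Rightarrow$ and temporal operators $\bigcirc,\Diamond,\Box,\mathcal{U},\mathcal{W}$ (next, sometime, always, until, unless) with the standard discrete linear-time semantics over models $\sigma=s_0,s_1,\dots$ (sequences of sets of proposition symbols); $\mathbf{start}$ holds exactly at index $0$. A literal is a proposition symbol or its negation. A PLTL-clause has one of the forms $\mathbf{start}\Rightarrow\bigvee_c l_c$ (initial), $\bigwedge_a k_a\Rightarrow\bigcirc\bigvee_d l_d$ (step), $\bigwedge_b k_b\Rightarrow\Diamond l$ (sometime), all $k,l$ literals; a clause set $\{A_i\}$ denotes $\Box\bigwedge_iA_i$. The literal $l$ of a sometime clause is an eventuality literal; $\neg C$ for a conjunction of literals $C$ is the disjunction of the complementary literals. The algorithm: (1) translate $A$ into a set $A_s$ of PLTL-clauses by the SNF translation $\tau_0$ (a renaming-based translation introducing finitely many new proposition symbols); (2) form the augmentation $Aug(A_s)$: for each eventuality literal $l$ introduce a new proposition symbol $w_l$ and add $w_l\Rightarrow\bigcirc(l\vee w_l)$, and for each sometime clause $C\Rightarrow\Diamond l$ add $\mathbf{start}\Rightarrow\neg C\vee l\vee w_l$ and $\mathbf{true}\Rightarrow\bigcirc(\neg C\vee l\vee w_l)$; (3) perform step resolution, together with simplification and subsumption, until either $\mathbf{start}\Rightarrow\mathbf{false}$ is derived (terminate: unsatisfiable) or no new resolvents are generated; (4) select an eventuality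 $\Diamond l$ from a sometime clause and search for loops in $\neg l$; (5) construct the loop resolvents for the loops found and each sometime clause with right-hand side $\Diamond l$; if any new clause (not subsumed by clauses present) is generated go to (3); (6) if all eventualities have been resolved, terminate declaring $A$ satisfiable, otherwise go to (4). Here: step resolution derives $\mathbf{start}\Rightarrow A\vee B$ from $\mathbf{start}\Rightarrow A\vee p$ and $\mathbf{start}\Rightarrow B\vee\neg p$, and $(C\wedge D)\Rightarrow\bigcirc(A\vee B)$ from $C\Rightarrow\bigcirc(A\vee p)$ and $D\Rightarrow\bigcirc(B\vee\neg p)$; a clause $A\Rightarrow\bigcirc\mathbf{false}$ is replaced by $\mathbf{start}\Rightarrow\neg A$ and $\mathbf{true}\Rightarrow\bigcirc\neg A$. Simplification removes duplicate literals, replaces clauses with complementary literals on the left by $\mathbf{false}\Rightarrow\bigcirc B$ and on the right by $A\Rightarrow\bigcirc\mathbf{true}$, removes $\mathbf{true}$ from conjunctions and $\mathbf{false}$ from disjunctions (with $\mathbf{false}$ in a left conjunction giving $\mathbf{false}\Rightarrow\bigcirc B$ and $\mathbf{true}$ in a right disjunction giving $A\Rightarrow\bigcirc\mathbf{true}$), and deletes clauses $\mathbf{false}\Rightarrow\bigcirc A$ and $A\Rightarrow\bigcirc\mathbf{true}$. Subsumption deletes $C\Rightarrow A$ if $D\Rightarrow B$ is present with $\vdash C\Rightarrow D$, $\vdash B\Rightarrow A$. SNF$_m$ clauses: step clauses, and $(A\wedge B)\Rightarrow\bigcirc(C\wedge D)$ formed from SNF$_m$ clauses $A\Rightarrow\bigcirc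 C$, $B\Rightarrow\bigcirc D$. A loop in $\neg l$ is a family of SNF$_m$ clauses $A_i\Rightarrow\bigcirc B_i$ ($0\le i\le n$) formed from step clauses of the current set with $B_i\Rightarrow\neg l$ and $B_i\Rightarrow\bigvee_j A_j$ propositional tautologies for all $i$. Its loop resolvents with $C\Rightarrow\Diamond l$ are, for each $i$, $\mathbf{start}\Rightarrow\neg C\vee l\vee\neg A_i$, $\mathbf{true}\Rightarrow\bigcirc(\neg C\vee l\vee\neg A_i)$ and $w_l\Rightarrow\bigcirc(l\vee\neg A_i)$. *)

(* Defs.v *)
From HB Require Import structures.
From mathcomp Require Import all_boot finmap.

Set Implicit Arguments.
Unset Strict Implicit.
Unset Printing Implicit Defensive.

Local Open Scope fset_scope.

(* PLTL formulae over the proposition symbols [P]; [Ev], [Alw], [Until] and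
   [Unless] are sometime, always, U and W. *)
Inductive form (P : Type) : Type :=
| Var of P
| Tru
| Fls
| Not of form P
| Or of form P & form P
| And of form P & form P
| Imp of form P & form P
| Next of form P
| Ev of form P
| Alw of form P
| Until of form P & form P
| Unless of form P & form P.

Arguments Tru {P}.
Arguments Fls {P}.

(* Symbols that may occur in clauses.  The new symbols are kept apart from those
   of the input and from each other by constructors: [Ren a] renames the
   subformula at address [a] (or is the auxiliary symbol attached to it), and
   [Wait s b] is the symbol w_l of the literal l = (s, b). *)
Inductive sym (P : Type) : Type :=
| Orig of P
| Ren of seq nat
| Wait of sym P & bool.

Arguments Ren {P}.

Section SymChoice.
Variable P : choiceType.

Fixpoint sym_enc (s : sym P) : GenTree.tree (P + seq nat) :=
  match s with
  | Orig p => GenTree.Leaf (inl p)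
  | Ren a => GenTree.Leaf (inr a)
  | Wait s b => GenTree.Node b [:: sym_enc s]
  end.

Fixpoint sym_dec (t : GenTree.tree (P + seq nat)) : sym P :=
  match t with
  | GenTree.Leaf (inl p) => Orig p
  | GenTree.Leaf (inr a) => Ren a
  | GenTree.Node b (t :: _) => Wait (sym_dec t) (b == 1)
  | GenTree.Node _ [::] => Ren [::]
  end.

Lemma sym_encK : cancel sym_enc sym_dec.
Proof. by elim=> //= s -> []. Qed.

HB.instance Definition _ := Choice.copy (sym P) (can_type sym_encK).
End SymChoice.

(* The literal (s, true) is s, and (s, false) is its negation. *)
Notation lit P := (sym P * bool)%type.

(* Disjuncts and conjuncts: the constants true and false, and literals. *)
Notation elt P := (bool + lit P)%type.
Notation Cst b := (inl b).
Notation Lit l := (inr l).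

(* A [seq (elt P)] is read as a conjunction on the left of a clause and as a
   disjunction on the right, so [::] is true on the left, false on the right.
     Initial r      start => \/ r
     Step k r       /\ k => next (\/ r)
     Sometime k l   /\ k => sometime l *)
Inductive clause (P : Type) : Type :=
| Initial of seq (elt P)
| Step of seq (elt P) & seq (elt P)
| Sometime of seq (elt P) & lit P.

Section ClauseChoice.
Variable P : choiceType.

Definition clause_enc (c : clause P) :
    seq (elt P) + (seq (elt P) * seq (elt P) + seq (elt P) * lit P) :=
  match c with
  | Initial r => inl r
  | Step k r => inr (inl (k, r))
  | Sometime k l => inr (inr (k, l))
  end.

Definition clause_dec
    (c : seq (elt P) + (seq (elt P) * seq (elt P) + seq (elt P) * lit P)) :=
  match c with
  | inl r => Initial r
  | inr (inl (k, r)) => Step k r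
  | inr (inr (k, l)) => Sometime k l
  end.

Lemma clause_encK : cancel clause_enc clause_dec.
Proof. by case. Qed.

HB.instance Definition _ := Choice.copy (clause P) (can_type clause_encK).
End ClauseChoice.

Section Translation.
Variable P : Type.
Implicit Types (A B : form P) (x y : sym P) (b : bool) (a : seq nat).

(* Below, the pair (A, b) stands for A if b and for its negation otherwise;
   negations are pushed inwards by flipping b. *)

Fixpoint as_lit A b : option (lit P) :=
  match A with
  | Var p => Some (Orig p, b)
  | Not A => as_lit A (~~ b)
  | _ => None
  end.

Definition cat_opt T (u v : option (seq T)) :=
  match u, v with
  | Some s, Some t => Some (s ++ t)
  | _, _ => None
  end.

(* The disjuncts of (A, b), if it is a disjunction of literals and constants. *)
Fixpoint as_disj A b : option (seq (elt P)) :=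
  match A, b with
  | Var p, _ => Some [:: Lit (Orig p, b)]
  | Tru, _ => Some [:: Cst b]
  | Fls, _ => Some [:: Cst (~~ b)]
  | Not A, _ => as_disj A (~~ b)
  | Or A B, true => cat_opt (as_disj A true) (as_disj B true)
  | And A B, false => cat_opt (as_disj A false) (as_disj B false)
  | Imp A B, true => cat_opt (as_disj A false) (as_disj B true)
  | _, _ => None
  end.

Definition pos x : elt P := Lit (x, true).
Definition neg x : elt P := Lit (x, false).

(* always (x => \/ r) *)
Definition glob x (r : seq (elt P)) : seq (clause P) :=
  [:: Initial (neg x :: r); Step [::] (neg x :: r)].

(* Renaming of an argument (A, b) by the symbol [Ren a], unless it already is a
   disjunction of literals (resp. a literal).  [tau y] is the translation of
   always (y => (A, b)). *)
Definition ren_disj A b a (tau : sym P -> seq (clause P)) :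
    seq (elt P) * seq (clause P) :=
  if as_disj A b is Some r then (r, [::]) else ([:: pos (Ren a)], tau (Ren a)).

Definition ren_lit A b a (tau : sym P -> seq (clause P)) :
    lit P * seq (clause P) :=
  if as_lit A b is Some l then (l, [::]) else ((Ren a, true), tau (Ren a)).

Definition tr_or x (u v : seq (elt P) * seq (clause P)) :=
  glob x (u.1 ++ v.1) ++ u.2 ++ v.2.

Definition tr_next x (u : seq (elt P) * seq (clause P)) :=
  Step [:: pos x] u.1 :: u.2.

Definition tr_ev x (u : lit P * seq (clause P)) :=
  Sometime [:: pos x] u.1 :: u.2.

(* x => always l, by x => l, x => y, y => next l, y => next y *)
Definition tr_alw x y (u : lit P * seq (clause P)) :=
  glob x [:: Lit u.1] ++ glob x [:: pos y]
    ++ [:: Step [:: pos y] [:: Lit u.1]; Step [:: pos y] [:: pos y]] ++ u.2.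

(* x => k W l, by x => l \/ k, x => l \/ y, y => next (l \/ k),
   y => next (l \/ y) *)
Definition tr_unless x y (u v : lit P * seq (clause P)) :=
  glob x [:: Lit v.1; Lit u.1] ++ glob x [:: Lit v.1; pos y]
    ++ [:: Step [:: pos y] [:: Lit v.1; Lit u.1];
           Step [:: pos y] [:: Lit v.1; pos y]] ++ u.2 ++ v.2.

Definition tr_until x y (u v : lit P * seq (clause P)) :=
  Sometime [:: pos x] v.1 :: tr_unless x y u v.

(* The translation of always (x => (A, b)), for A at address a.  A negated
   until is ~(A U B) = ~B W (~A /\ ~B), and dually for unless; the conjunction
   is not a literal, so it is always renamed. *)
Fixpoint tau1 A a b x : seq (clause P) :=
  let y := Ren (0 :: a) in
  match A with
  | Var p => glob x [:: Lit (Orig p, b)]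
  | Tru => glob x [:: Cst b]
  | Fls => glob x [:: Cst (~~ b)]
  | Not A => tau1 A a (~~ b) x
  | Or A B =>
      if b then tr_or x (ren_disj A b (1 :: a) (tau1 A (1 :: a) b))
                        (ren_disj B b (2 :: a) (tau1 B (2 :: a) b))
      else tau1 A (1 :: a) b x ++ tau1 B (2 :: a) b x
  | And A B =>
      if b then tau1 A (1 :: a) b x ++ tau1 B (2 :: a) b x
      else tr_or x (ren_disj A b (1 :: a) (tau1 A (1 :: a) b))
                   (ren_disj B b (2 :: a) (tau1 B (2 :: a) b))
  | Imp A B =>
      if b then tr_or x (ren_disj A (~~ b) (1 :: a) (tau1 A (1 :: a) (~~ b)))
                        (ren_disj B b (2 :: a) (tau1 B (2 :: a) b))
      else tau1 A (1 :: a) (~~ b) x ++ tau1 B (2 :: a) b x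
  | Next A => tr_next x (ren_disj A b (1 :: a) (tau1 A (1 :: a) b))
  | Ev A =>
      let u := ren_lit A b (1 :: a) (tau1 A (1 :: a) b) in
      if b then tr_ev x u else tr_alw x y u
  | Alw A =>
      let u := ren_lit A b (1 :: a) (tau1 A (1 :: a) b) in
      if b then tr_alw x y u else tr_ev x u
  | Until A B =>
      if b then tr_until x y (ren_lit A b (1 :: a) (tau1 A (1 :: a) b))
                             (ren_lit B b (2 :: a) (tau1 B (2 :: a) b))
      else
        let z := Ren (2 :: a) in
        tr_unless x y (ren_lit B b (1 :: a) (tau1 B (1 :: a) b))
          ((z, true), tau1 A [:: 1, 2 & a] b z ++ tau1 B [:: 2, 2 & a] b z)
  | Unless A B =>
      if b then tr_unless x y (ren_lit A b (1 :: a) (tau1 A (1 :: a) b))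
                              (ren_lit B b (2 :: a) (tau1 B (2 :: a) b))
      else
        let z := Ren (2 :: a) in
        tr_until x y (ren_lit B b (1 :: a) (tau1 B (1 :: a) b))
          ((z, true), tau1 A [:: 1, 2 & a] b z ++ tau1 B [:: 2, 2 & a] b z)
  end.

Definition tau0 A : seq (clause P) :=
  Initial [:: pos (Ren [::])] :: tau1 A [::] true (Ren [::]).

Definition neg_lit (l : lit P) : lit P := (l.1, ~~ l.2).

Definition neg_elt (e : elt P) : elt P :=
  match e with
  | Cst b => Cst (~~ b)
  | Lit l => Lit (neg_lit l)
  end.

Definition wait (l : lit P) : elt P := pos (Wait l.1 l.2).

Definition aug_clause (c : clause P) : seq (clause P) :=
  if c is Sometime k l then
    let r := map neg_elt k ++ [:: Lit l; wait l] in
    [:: Step [:: wait l] [:: Lit l; wait l]; Initial r; Step [::] r]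
  else [::].

Definition aug (N : seq (clause P)) : seq (clause P) :=
  N ++ flatten (map aug_clause N).

End Translation.

Section Rules.
Variable P : choiceType.
Implicit Types (N : {fset clause P}) (c d : clause P) (k r : seq (elt P)).
Implicit Types (l : lit P).

Definition clashing k := has (fun e => neg_elt e \in k) k.

(* [None] is the conjunction false, resp. the disjunction true. *)
Definition simp_conj k : option (seq (elt P)) :=
  if (Cst false \in k) || clashing k then None
  else Some (undup [seq e <- k | e != Cst true]).

Definition simp_disj r : option (seq (elt P)) :=
  if (Cst true \in r) || clashing r then None
  else Some (undup [seq e <- r | e != Cst false]).

(* The clauses that replace [c] once it is fully simplified: none if it is
   deleted, two if its right-hand side is next false. *)
Definition simplify c : seq (clause P) :=
  match c with
  | Initial r => if simp_disj r is Some r' then [:: Initial r'] else [::]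
  | Step k r =>
      match simp_conj k, simp_disj r with
      | Some k', Some [::] =>
          [:: Initial (map (@neg_elt P) k'); Step [::] (map (@neg_elt P) k')]
      | Some k', Some r' => [:: Step k' r']
      | _, _ => [::]
      end
  | Sometime _ _ => [:: c]
  end.

Definition simplify_all (s : seq (clause P)) : seq (clause P) :=
  flatten (map simplify s).

Inductive resolvent : clause P -> clause P -> clause P -> Prop :=
| ResInitial r1 r2 l of Lit l \in r1 & Lit (neg_lit l) \in r2 :
    resolvent (Initial r1) (Initial r2)
      (Initial (rem (Lit l) r1 ++ rem (Lit (neg_lit l)) r2))
| ResStep k1 r1 k2 r2 l of Lit l \in r1 & Lit (neg_lit l) \in r2 :
    resolvent (Step k1 r1) (Step k2 r2)
      (Step (k1 ++ k2) (rem (Lit l) r1 ++ rem (Lit (neg_lit l)) r2)).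

Definition eval_lit (v : sym P -> bool) l : bool := v l.1 == l.2.

Definition eval_elt (v : sym P -> bool) (e : elt P) : bool :=
  match e with
  | Cst b => b
  | Lit l => eval_lit v l
  end.

Definition eval_conj v k : bool := all (eval_elt v) k.
Definition eval_disj v r : bool := has (eval_elt v) r.
Definition eval_cnf v (B : seq (seq (elt P))) : bool := all (eval_disj v) B.

(* Truth at index i of the model m of the two sides of a clause. *)
Definition lhs_holds c (m : nat -> sym P -> bool) (i : nat) : Prop :=
  match c with
  | Initial _ => i = 0
  | Step k _ | Sometime k _ => eval_conj (m i) k
  end.

Definition rhs_holds c (m : nat -> sym P -> bool) (i : nat) : Prop :=
  match c with
  | Initial r => eval_disj (m i) r
  | Step _ r => eval_disj (m i.+1) r
  | Sometime _ l => exists2 j, i <= j & eval_lit (m j) l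
  end.

Definition subsumes d c : Prop :=
  (forall m i, lhs_holds c m i -> lhs_holds d m i) /\
  (forall m i, rhs_holds d m i -> rhs_holds c m i).

(* A generated clause is new if it is not subsumed by a clause present. *)
Definition new N c : Prop := ~ exists2 d, d \in N & subsumes d c.

(* [snfm N A B]: /\ A => next (/\ of the disjunctions B) is an SNF_m clause
   formed from step clauses of N. *)
Inductive snfm N : seq (elt P) -> seq (seq (elt P)) -> Prop :=
| SnfmStep k r of Step k r \in N : snfm N k [:: r]
| SnfmAnd A B C D of snfm N A C & snfm N B D : snfm N (A ++ B) (C ++ D).

(* A loop in the negation of l, as the list of the pairs (A_i, B_i). *)
Definition is_loop N l (L : seq (seq (elt P) * seq (seq (elt P)))) : Prop :=
  L <> [::] /\
  (forall AB, AB \in L ->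
     [/\ snfm N AB.1 AB.2,
         forall v, eval_cnf v AB.2 -> eval_lit v (neg_lit l)
       & forall v, eval_cnf v AB.2 -> has (fun AB' => eval_conj v AB'.1) L]).

(* The loop resolvents of L with /\ k => sometime l. *)
Definition loop_resolvents k l (L : seq (seq (elt P) * seq (seq (elt P)))) :
    seq (clause P) :=
  flatten [seq let nA := map (@neg_elt P) AB.1 in
               let r := map (@neg_elt P) k ++ Lit l :: nA in
               [:: Initial r; Step [::] r; Step [:: wait l] (Lit l :: nA)]
          | AB <- L].

Definition loop_clauses N l
    (Ls : seq (seq (seq (elt P) * seq (seq (elt P))))) : seq (clause P) :=
  simplify_all (flatten
    [seq if c is Sometime k l' then
           if l' == l then flatten (map (loop_resolvents k l) Ls) else [::]
         else [::]
    | c <- enum_fset N]).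

Definition eventuality N l : Prop := exists k, Sometime k l \in N.

(* [Resolving N] is in step (3) with clause set N; [Selecting N D] is in steps
   (4)-(6), D being the eventualities resolved since N was last changed. *)
Inductive state : Type :=
| Resolving of {fset clause P}
| Selecting of {fset clause P} & {fset lit P}
| Unsatisfiable
| Satisfiable.

Definition start (A : form P) : state :=
  Resolving [fset c in simplify_all (aug (tau0 A))].

Definition contradictory N : Prop := Initial [::] \in N.

(* The transitions leave open which resolvent, subsumed clause or unresolved
   eventuality is treated next, and which loops are found first; but an
   eventuality is resolved only if no loop at all yields a new clause. *)
Inductive run_step : state -> state -> Prop :=
| Contradiction N of contradictory N :
    run_step (Resolving N) Unsatisfiable
| Resolve N c1 c2 c of
    ~ contradictory N & c1 \in N & c2 \in N & resolvent c1 c2 c &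
    (exists2 d, d \in simplify c & new N d) :
    run_step (Resolving N) (Resolving (N `|` [fset d in simplify c]))
| Subsume N c d of
    ~ contradictory N & c \in N & d \in N & d <> c & subsumes d c :
    run_step (Resolving N) (Resolving (N `\ c))
| Saturated N of
    ~ contradictory N &
    (forall c1 c2 c d, c1 \in N -> c2 \in N -> resolvent c1 c2 c ->
       d \in simplify c -> ~ new N d) :
    run_step (Resolving N) (Selecting N fset0)
| LoopsFound N D l Ls of
    eventuality N l & l \notin D &
    (forall L, L \in Ls -> is_loop N l L) &
    (exists2 c, c \in loop_clauses N l Ls & new N c) :
    run_step (Selecting N D)
      (Resolving (N `|` [fset c in loop_clauses N l Ls]))
| Resolved N D l of
    eventuality N l & l \notin D &
    (forall Ls c, (forall L, L \in Ls -> is_loop N l L) ->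
       c \in loop_clauses N l Ls -> ~ new N c) :
    run_step (Selecting N D) (Selecting N (l |` D))
| AllResolved N D of (forall l, eventuality N l -> l \in D) :
    run_step (Selecting N D) Satisfiable.

(* Every run from a state is finite and ends with a verdict. *)
Inductive terminates : state -> Prop :=
| TermUnsat : terminates Unsatisfiable
| TermSat : terminates Satisfiable
| TermStep s of
    (exists s', run_step s s') & (forall s', run_step s s' -> terminates s') :
    terminates s.

End Rules.

(* Main.v *)
(* All clauses generated are simplified clauses over the finitely many symbols of
   the augmented translation, so they lie in a finite set U.  Adding a new clause
   strictly shrinks the set of clauses of U not subsumed by the current set N,
   whereas deleting a subsumed clause keeps it and shrinks N, because subsumption
   is transitive.  Between two additions of new clauses there are thus finitely
   many deletions, and each eventuality is marked as resolved at most once. *)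

Require Import Defs.
From mathcomp Require Import all_boot finmap.
From mathcomp Require Import boolp.

Set Implicit Arguments.
Unset Strict Implicit.
Unset Printing Implicit Defensive.

Local Open Scope fset_scope.

(** * Counting and bounded sequences *)

Lemma count_lt (T : eqType) (a b : pred T) (s : seq T) (x : T) :
  subpred a b -> x \in s -> ~~ a x -> b x -> count a s < count b s.
Proof.
move=> ab; elim: s => //= y s IHs; rewrite inE => /orP[/eqP-> | xs] nax bx.
  by rewrite (negbTE nax) bx ltnS sub_count.
by rewrite -addnS leq_add ?IHs //; case ay: (a y); rewrite // (ab _ ay).
Qed.

Fixpoint bounded_seqs (T : Type) (n : nat) (s : seq T) : seq (seq T) :=
  if n is m.+1 then [::] :: [seq x :: t | x <- s, t <- bounded_seqs m s]
  else [:: [::]].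

Lemma mem_bounded_seqs (T : eqType) n (s t : seq T) :
  {subset t <= s} -> size t <= n -> t \in bounded_seqs n s.
Proof.
elim: n t => [|n IHn] [|x t] //= ts le_tn; rewrite inE /=.
apply: allpairs_f; first by apply: ts; rewrite mem_head.
by apply: IHn => // y yt; apply: ts; rewrite inE yt orbT.
Qed.

(** * Subsumption and new clauses *)

Section Subsumption.
Variable P : choiceType.
Implicit Types (N : {fset clause P}) (c d : clause P).

Lemma subsumes_trans c2 c1 c3 :
  subsumes c1 c2 -> subsumes c2 c3 -> subsumes c1 c3.
Proof. by move=> [l12 r12] [l23 r23]; split=> m i; auto. Qed.

Lemma mem_not_new N c : c \in N -> ~ new N c.
Proof. by move=> cN; apply; exists c. Qed.

Lemma new_subset N N' c : N `<=` N' -> new N' c -> new N c.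
Proof. by move=> /fsubsetP NN' nc [d /NN' dN dc]; apply: nc; exists d. Qed.

(** Whatever the deleted [c] subsumes is also subsumed by [d], which survives because it differs
    from [c]. *)
Lemma new_deletion N c d e :
  d \in N -> d <> c -> subsumes d c -> new (N `\ c) e -> new N e.
Proof.
move=> dN d_c dc ne [c' c'N c'e]; apply: ne.
have [eq_c'c | c'_c] := eqVneq c' c.
  exists d; first by rewrite !inE dN andbT; apply/eqP.
  by apply: subsumes_trans c'e; rewrite eq_c'c.
by exists c'; rewrite // !inE c'_c.
Qed.

End Subsumption.

(** * The finite universe of simplified clauses *)

Section Simplification.
Variable P : choiceType.
Implicit Types (k r E : seq (elt P)).

Lemma neg_eltK : involutive (@neg_elt P).
Proof. by case=> [b | [x b]]; rewrite /= /neg_lit /= negbK. Qed.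

Lemma simp_conjP k k' :
  simp_conj k = Some k' -> {subset k' <= k} /\ uniq k'.
Proof.
rewrite /simp_conj; case: ifP => // _ [<-]; split; last exact: undup_uniq.
by move=> e; rewrite mem_undup mem_filter => /andP[].
Qed.

Lemma simp_disjP r r' :
  simp_disj r = Some r' -> {subset r' <= r} /\ uniq r'.
Proof.
rewrite /simp_disj; case: ifP => // _ [<-]; split; last exact: undup_uniq.
by move=> e; rewrite mem_undup mem_filter => /andP[].
Qed.

Definition clause_elts (c : clause P) : seq (elt P) :=
  match c with
  | Initial r => r
  | Step k r => k ++ r
  | Sometime k l => Lit l :: k
  end.

Definition is_sometime (c : clause P) : bool :=
  if c is Sometime _ _ then true else false.

(* Sometime clauses may have repeated literals, but none is ever generated, so
   those of the input suffice. *)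
Definition simplified_clauses E (N0 : seq (clause P)) : seq (clause P) :=
  let S := bounded_seqs (size E) E in
  map (@Initial P) S ++ [seq Step k r | k <- S, r <- S]
    ++ filter is_sometime N0.

(** Simplification drops elements and repetitions; fresh elements arise only by negating the left
    side of a clause with right side next false, whence the closure of [E] under negation. *)
Lemma simplify_sub E N0 c :
    {homo @neg_elt P : e / e \in E} ->
    {subset clause_elts c <= E} -> (is_sometime c -> c \in N0) ->
  {subset simplify c <= simplified_clauses E N0}.
Proof.
move=> negE; set S := bounded_seqs (size E) E.
(* A list without repetitions over [E] is no longer than [E]; this justifies the length bound in the
   universe. *)
have memS s : {subset s <= E} -> uniq s -> s \in S.
  by move=> sE s_uniq; rewrite mem_bounded_seqs // uniq_leq_size.
have init s : s \in S -> Initial s \in simplified_clauses E N0.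
  by move=> sS; rewrite !mem_cat map_f.
have step s t : s \in S -> t \in S -> Step s t \in simplified_clauses E N0.
  by move=> sS tS; rewrite !mem_cat allpairs_f ?orbT.
case: c => [r | k r | k l] /= cE cN0 d.
- case Dr: simp_disj => [r'|] //; have [r'r r'_uniq] := simp_disjP Dr.
  by rewrite inE => /eqP->; apply/init/memS => // e /r'r/cE.
- case Dk: simp_conj => [k'|] //; have [k'k k'_uniq] := simp_conjP Dk.
  case Dr: simp_disj => [r'|] //; have [r'r r'_uniq] := simp_disjP Dr.
  have k'E: {subset k' <= E} by move=> e /k'k ek; rewrite cE ?mem_cat ?ek.
  have r'E: {subset r' <= E} by move=> e /r'r er; rewrite cE ?mem_cat ?er ?orbT.
  case: r' {Dr r'r} r'_uniq r'E => [|e r'] r'_uniq r'E; last first.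
    by rewrite inE => /eqP->; apply: step; apply: memS.
  (* Negation is injective, so the negated left side still has no repetitions. *)
  have nk'S: map (@neg_elt P) k' \in S.
    apply: memS; last by rewrite map_inj_uniq //; apply: inv_inj neg_eltK.
    by move=> _ /mapP[e ek' ->]; apply/negE/k'E.
  rewrite !inE => /orP[]/eqP->; first exact: init.
  by apply: step => //; apply: memS.
- by rewrite inE => /eqP->; rewrite !mem_cat mem_filter cN0 ?orbT.
Qed.

Lemma simplified_elts E N0 c :
    c \in simplified_clauses E N0 -> ~~ is_sometime c ->
  {subset clause_elts c <= E}.
Proof.
have subE n s : s \in bounded_seqs n E -> {subset s <= E}.
  elim: n s => [|n IHn] s /=; first by rewrite inE => /eqP->.
  rewrite inE => /orP[/eqP-> // |].
  case/allpairsP=> -[x t] /= [xE /IHn tE ->] y.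
  by rewrite inE => /orP[/eqP-> // | /tE].
rewrite !mem_cat => /or3P[/mapP[r /subE rE ->] // | |].
  case/allpairsP=> -[k r] /= [/subE kE /subE rE ->] _ e.
  by rewrite mem_cat => /orP[/kE | /rE].
by rewrite mem_filter => /andP[->].
Qed.

End Simplification.

(** * Closure of the universe under the rules, measures and termination of runs *)

Section Runs.
Variables (P : choiceType) (E : seq (elt P)) (N0 : seq (clause P)).
Hypothesis negE : {homo @neg_elt P : e / e \in E}.
Hypothesis eltsE : forall c, c \in N0 -> {subset clause_elts c <= E}.
Hypothesis waitE : forall k l, Sometime k l \in N0 -> wait l \in E.
Implicit Types (N : {fset clause P}) (c d : clause P).

Let U := simplified_clauses E N0.

Lemma sometime_input k l : Sometime k l \in U -> Sometime k l \in N0.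
Proof.
rewrite !mem_cat => /or3P[/mapP[? _ //] | /allpairsP[? [_ _ //]] |].
by rewrite mem_filter => /andP[].
Qed.

Lemma universe_elts c : c \in U -> {subset clause_elts c <= E}.
Proof.
case Dc: (is_sometime c) => cU; last by apply: simplified_elts cU _; rewrite Dc.
by apply: eltsE; case: c Dc cU => // k l _; apply: sometime_input.
Qed.

Lemma neg_conjE k :
  {subset k <= E} -> {subset map (@neg_elt P) k <= E}.
Proof. by move=> kE _ /mapP[e /kE eE ->]; apply: negE. Qed.

Lemma resolvent_sub c1 c2 c :
  resolvent c1 c2 c -> c1 \in U -> c2 \in U -> {subset simplify c <= U}.
Proof.
move=> res /universe_elts c1E /universe_elts c2E.
apply: simplify_sub => //; last by case: res.
case: res c1E c2E => [r1 r2 l _ _ | k1 r1 k2 r2 l _ _] /= c1E c2E e.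
  by rewrite mem_cat => /orP[/mem_rem/c1E | /mem_rem/c2E].
rewrite !mem_cat -orbA => /or4P[] eP.
- by apply: c1E; rewrite mem_cat eP.
- by apply: c2E; rewrite mem_cat eP.
- by apply: c1E; rewrite mem_cat (mem_rem eP) orbT.
- by apply: c2E; rewrite mem_cat (mem_rem eP) orbT.
Qed.

(** There is no bound on the length of these left sides, but conjoining clauses introduces no new
    elements; simplification later removes the repetitions. *)
Lemma snfm_lhs_sub N A B :
  {subset N <= U} -> snfm N A B -> {subset A <= E}.
Proof.
move=> NU; elim=> [k r /NU/universe_elts krE e ek | A1 A2 C D _ A1E _ A2E e].
  by apply: krE; rewrite mem_cat ek.
by rewrite mem_cat => /orP[/A1E | /A2E].
Qed.

(** The elements come from the sometime clause, from [wait l] and from the left sides in the loop,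
    up to negation; [waitE] accounts for [wait l]. *)
Lemma loop_resolvents_sub N k l L c :
    {subset N <= U} -> Sometime k l \in N -> is_loop N l L ->
    c \in loop_resolvents k l L ->
  {subset simplify c <= U}.
Proof.
move=> NU klN [_ loopL] /flattenP[_ /mapP[AB /loopL[snfmAB _ _] ->] cAB].
have /sometime_input klN0 := NU _ klN.
have klE := eltsE klN0; have wE := waitE klN0.
have lE: Lit l \in E by apply: klE; rewrite mem_head.
have nkE: {subset map (@neg_elt P) k <= E}.
  by apply: neg_conjE => e ek; apply: klE; rewrite inE ek orbT.
have nAE := neg_conjE (snfm_lhs_sub NU snfmAB).
have lnAE: {subset Lit l :: map (@neg_elt P) AB.1 <= E}.
  by move=> e; rewrite inE => /orP[/eqP-> // | /nAE].
have rE: {subset map (@neg_elt P) k ++ Lit l :: map (@neg_elt P) AB.1 <= E}.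
  by move=> e; rewrite mem_cat => /orP[/nkE | /lnAE].
apply: simplify_sub => //; move: cAB; rewrite !inE => /or3P[]/eqP-> //= e.
by rewrite inE => /orP[/eqP-> // | /lnAE].
Qed.

Lemma loop_clauses_sub N l Ls :
    {subset N <= U} -> (forall L, L \in Ls -> is_loop N l L) ->
  {subset loop_clauses N l Ls <= U}.
Proof.
move=> NU loops d /flattenP[_ /mapP[c /flattenP[_ /mapP[c' c'N ->] cc'] ->]].
case: c' c'N cc' => // k l' klN; case: eqP => // eq_l'; subst l'.
case/flattenP=> _ /mapP[L /loops loopL ->].
by move/(loop_resolvents_sub NU klN loopL); apply.
Qed.

(** Subsumption quantifies over all models, so [new] is made boolean classically in order to be
    counted. *)
Let uncovered N : nat := count (fun c => `[< new N c >]) U.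

Lemma uncovered_add N (s : seq (clause P)) c :
    c \in s -> c \in U -> new N c ->
  uncovered (N `|` [fset d in s]) < uncovered N.
Proof.
move=> cs cU cnew; apply: (count_lt (x := c)) => //; last exact/asboolP.
  by move=> d /asboolP nd; apply/asboolP; apply: new_subset nd; apply: fsubsetUl.
(* The added clause [c] subsumes itself, so it leaves the count. *)
by apply/asboolP/mem_not_new; rewrite !inE cs orbT.
Qed.

Lemma uncovered_deletion N c d :
    d \in N -> d <> c -> subsumes d c ->
  uncovered (N `\ c) <= uncovered N.
Proof.
move=> dN d_c dc; apply: sub_count => e /asboolP ne.
exact/asboolP/(new_deletion dN d_c dc ne).
Qed.

Lemma add_sub N (s : seq (clause P)) :
  {subset N <= U} -> {subset s <= U} -> {subset N `|` [fset d in s] <= U}.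
Proof. by move=> NU sU c; rewrite !inE => /orP[/NU | /sU]. Qed.

(** By excluded middle: without a contradiction, the failure of [Resolve] for every pair of clauses
    is the premise of [Saturated]. *)
Lemma resolving_progress N : exists s, run_step (Resolving N) s.
Proof.
have [contr | ncontr] := pselect (contradictory N).
  by exists (Unsatisfiable P); constructor.
have [[c1 [c2 [c [c1N c2N res newc]]]] | nonew] := pselect (exists c1 c2 c,
    [/\ c1 \in N, c2 \in N, resolvent c1 c2 c
      & exists2 d, d \in simplify c & new N d]).
  by exists (Resolving (N `|` [fset d in simplify c])); apply: Resolve res _.
exists (Selecting N fset0); constructor=> // c1 c2 c d c1N c2N res dc nd.
by apply: nonew; exists c1, c2, c; split=> //; exists d.
Qed.

(** For an unresolved eventuality the premises of [LoopsFound] and [Resolved] are complementary; if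
    there is none, [AllResolved] applies. *)
Lemma selecting_progress N D : exists s, run_step (Selecting N D) s.
Proof.
have [[l [lN lD]] | done] := pselect (exists l, eventuality N l /\ l \notin D);
  last first.
  exists (Satisfiable P); constructor=> l lN.
  by apply/negPn/negP => lD; apply: done; exists l.
have [[Ls [loops newLs]] | nonew] := pselect (exists Ls,
    (forall L, L \in Ls -> is_loop N l L) /\
    exists2 c, c \in loop_clauses N l Ls & new N c).
  by exists (Resolving (N `|` [fset c in loop_clauses N l Ls])); constructor.
exists (Selecting N (l |` D)); constructor=> // Ls c loops cLs nc.
by apply: nonew; exists Ls; split=> //; exists c.
Qed.

(** Read off [N0] rather than the current set: sometime clauses are never generated, so this list is
    fixed along a run. *)
Let eventualities : seq (lit P) :=
  pmap (fun c => if c is Sometime _ l then Some l else None) N0.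

Let unresolved (D : {fset lit P}) : nat :=
  count (fun l => l \notin D) eventualities.

Lemma unresolved_add N D l :
    {subset N <= U} -> eventuality N l -> l \notin D ->
  unresolved (l |` D) < unresolved D.
Proof.
move=> NU [k /NU/sometime_input klN0] lD; apply: (count_lt (x := l)) => //.
- by move=> l'; rewrite !inE negb_or => /andP[].
- by rewrite mem_pmap; apply/mapP; exists (Sometime k l).
- by rewrite !inE eqxx.
Qed.

(** The second premise is the outer induction hypothesis, used when a loop yields a new clause;
    otherwise [unresolved D] decreases. *)
Lemma selecting_terminates N D :
    {subset N <= U} ->
    (forall N', {subset N' <= U} -> uncovered N' < uncovered N ->
       terminates (Resolving N')) ->
  terminates (Selecting N D).
Proof.
move=> NU IHN; have [m] := ubnP (unresolved D).
elim: m D => // m IHm D leDm; apply: TermStep; first exact: selecting_progress.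
move=> s' run; inversion run as [| | | | N1 D1 l Ls _ _ loops newc | N1 D1 l ev lD _ |];
  subst; last exact: TermSat.
  have LsU := loop_clauses_sub NU loops; have [c cLs cnew] := newc.
  by apply: IHN; [apply: add_sub | apply: uncovered_add cLs (LsU _ cLs) cnew].
by apply: IHm; apply: leq_trans (unresolved_add NU ev lD) _; rewrite -ltnS.
Qed.

Lemma resolving_terminates N : {subset N <= U} -> terminates (Resolving N).
Proof.
have [n] := ubnP (uncovered N); elim: n N => // n IHn N leNn NU.
(* The inner induction on cardinality handles deletions, which may leave [uncovered] unchanged. *)
have [m] := ubnP #|` N|; elim: m N leNn NU => // m IHm N leNn NU leNm.
have IH N' : {subset N' <= U} -> uncovered N' < uncovered N ->
    terminates (Resolving N').
  by move=> N'U ltN'; apply: IHn => //; apply: leq_trans ltN' _; rewrite -ltnS.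
apply: TermStep; first exact: resolving_progress.
move=> s' run; inversion run as [| N1 c1 c2 c _ c1N c2N res newc
  | N1 c d _ cN dN d_c dc | | | |]; subst; first exact: TermUnsat.
- have cU := resolvent_sub res (NU _ c1N) (NU _ c2N); have [d dc dnew] := newc.
  by apply: IH; [apply: add_sub | apply: uncovered_add dc (cU _ dc) dnew].
- apply: IHm; first exact: leq_ltn_trans (uncovered_deletion dN d_c dc) leNn.
    by move=> e; rewrite !inE => /andP[_ /NU].
  by move: leNm; rewrite (cardfsD1 c) cN.
- exact: selecting_terminates.
Qed.

End Runs.

(** * The universe of an augmented clause set *)

Lemma aug_terminates (P : choiceType) (N : seq (clause P)) :
  terminates (Resolving [fset c in simplify_all (aug N)]).
Proof.
set N0 := aug N.
pose E0 := flatten (map (@clause_elts P) N0).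
(* Negation is an involution, so adding the negations once gives a closed set. *)
pose E := E0 ++ map (@neg_elt P) E0.
have negE: {homo @neg_elt P : e / e \in E}.
  move=> e; rewrite !mem_cat => /orP[eE0 | /mapP[e' eE0 ->]].
    by apply/orP; right; apply: map_f.
  by rewrite neg_eltK eE0.
have eltsE c : c \in N0 -> {subset clause_elts c <= E}.
  move=> cN0 e ec; rewrite mem_cat; apply/orP; left.
  by apply/flattenP; exists (clause_elts c); rewrite ?map_f.
have waitE k l : Sometime k l \in N0 -> wait l \in E.
  have aug_sub c : c \in N -> {subset aug_clause c <= N0}.
    move=> cN d dc; rewrite mem_cat; apply/orP; right.
    by apply/flattenP; exists (aug_clause c); rewrite ?map_f.
  (* Augmentation adds only initial and step clauses, so the sometime clause lies in [N]; the first
     clause added for it has [wait l] as its left side. *)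
  rewrite mem_cat => /orP[klN | /flattenP[_ /mapP[[r|k' r|k' l'] _ ->]]] //.
  exact: eltsE (aug_sub _ klN _ (mem_head _ _)) _ (mem_head _ _).
apply: (resolving_terminates negE eltsE waitE) => d; rewrite inE /=.
case/flattenP=> _ /mapP[c cN0 ->]; apply: simplify_sub => //.
exact: eltsE.
Qed.

Theorem theorem5 (P : choiceType) (A : form P) : terminates (start A).
Proof. exact: aug_terminates. Qed.
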